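(* Let $\xi$ and $q$ be positive numbers with $\xi<2q$, let $n\in\mathbb{N}$, and let $\beta_n^*$ and $\tilde{\beta}_n$ be the unique zeros of the equations $\xi(1-\cos\beta)+\beta\sin\beta=0$ and $2q(1-\cos\beta)+\beta\sin\beta=0$ in $(2(n-1)\pi,\,2n\pi)$, respectively. Let the map $(\delta,h_2)$ from $(2(n-1)\pi,\,2n\pi)$ to $\mathbb{R}^2$ be defined by $$\delta(\beta)=\frac{\xi\beta^2(1-\cos\beta)+\beta^3\sin\beta}{2q(1-\cos\beta)+\beta\sin\beta},\qquad h_2(\beta)=\frac{q\beta(1-\cos\beta)-\xi\beta-q\xi\sin\beta}{\xi\beta(1-\cos\beta)+\beta^2\sin\beta}.$$ Then $(\delta,h_2)(\beta)$ is positive (i.e. $\delta(\beta)>0$ and $h_2(\beta)>0$) if and only if $$\beta\in(\gamma_n^*,\,\beta_n^* )\cup(\tilde{\gamma}_n,\,2n\pi),$$ where $\gamma_n^*\in(2(n-1)\pi,\,\beta_n^* )$ and $\tilde{\gamma}_n\in(\tilde{\beta}_n,\,2n\pi)$ are the two zeros of $h_2$ in $(2(n-1)\pi,2n\pi)$.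
   Context: $\mathbb{N}=\{1,2,3,\dots\}$. Each of the two equations has exactly one zero in $(2(n-1)\pi,2n\pi)$, and when $\xi<2q$ the function $h_2$ has exactly two zeros in $(2(n-1)\pi,2n\pi)$. The variable $\beta$ ranges over $(2(n-1)\pi,2n\pi)$, and positivity is understood at points where the denominators of $\delta$ and $h_2$ are nonzero. *)

(* Defs.v *)
From Stdlib Require Import Reals.
Open Scope R_scope.

Definition in_interval (n : nat) (b : R) : Prop :=
  2 * (INR n - 1) * PI < b < 2 * INR n * PI.

Definition is_zero_in (n : nat) (f : R -> R) (b : R) : Prop :=
  in_interval n b /\ f b = 0.

(* Left-hand side of both trigonometric equations: [c = xi] for the first,
   [c = 2 * q] for the second. *)
Definition trig_eq (c b : R) : R := c * (1 - cos b) + b * sin b.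

Definition delta_num (xi b : R) : R :=
  xi * b ^ 2 * (1 - cos b) + b ^ 3 * sin b.
Definition delta_den (q b : R) : R := 2 * q * (1 - cos b) + b * sin b.
Definition delta (xi q b : R) : R := delta_num xi b / delta_den q b.

Definition h2_num (xi q b : R) : R :=
  q * b * (1 - cos b) - xi * b - q * xi * sin b.
Definition h2_den (xi b : R) : R :=
  xi * b * (1 - cos b) + b ^ 2 * sin b.
Definition h2 (xi q b : R) : R := h2_num xi q b / h2_den xi b.

(* Division is total in Rocq, so the poles of [delta] and [h2] have to be
   excluded explicitly in the next two definitions. *)
Definition is_h2_zero (xi q : R) (n : nat) (b : R) : Prop :=
  in_interval n b /\ h2_den xi b <> 0 /\ h2 xi q b = 0.

Definition delta_h2_positive (xi q b : R) : Prop :=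
  delta_den q b <> 0 /\ h2_den xi b <> 0 /\
  delta xi q b > 0 /\ h2 xi q b > 0.

(* Main.v *)
Require Import Defs.
From Stdlib Require Import Reals Lra Psatz.
Open Scope R_scope.

(** Write [b = L + 2 * t] with [L = 2 * (n - 1) * PI >= 0] and [0 < t < PI].
    The half-angle formulas turn every expression into a positive factor times
    a function of [cot t] and [b]:

    - [trig_eq c b = 2 * (sin t)^2 * (c + b * cot t)];
    - [delta] is [b^2] times the quotient of [trig_eq xi b] by
      [trig_eq (2 * q) b], and [h2_den] is [b * trig_eq xi b];
    - [h2_num b = b * (sin t)^2 * P], where
      [P = 2 * q - xi - xi * cot t * (cot t + 2 * q / b)].

    As [t] grows past [PI / 2], [cot t] is negative and decreasing while [b]
    is positive and increasing, so [b * cot t] decreases from [0] to minus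
    infinity; before [PI / 2] it is nonnegative. Hence it takes each value
    [- c < 0] once, crossing it downwards ([bcot_crossing]). Since
    [xi < 2 * q], the zero for [xi] precedes the one for [2 * q], and [delta]
    is positive exactly outside the segment between them.

    The sign of [P] follows from the same monotonicity, in three zones. Up to
    [PI / 2], both [cot t] and [1 / b] decrease and are nonnegative, so [P]
    increases. While [- 2 * q <= b * cot t <= 0], the product
    [cot t * (cot t + 2 * q / b)] is at most [0], so [P > 0]. Beyond the zero
    for [2 * q], both [- cot t] and [- cot t - 2 * q / b] are nonnegative and
    increase, so [P] decreases. As [P] is negative near both ends, it has one
    zero in each outer zone and is positive exactly between them
    ([h2_factor_sign]). The theorem combines these sign patterns: [h2] has the
    sign of [P] before the zero for [xi] and the opposite sign after it. *)

(** * Half-angle form *)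

Definition cot (t : R) : R := cos t / sin t.

Definition bcot (L t : R) : R := (L + 2 * t) * cot t.

Definition h2_factor (xi q L t : R) : R :=
  2 * q - xi - xi * (cot t * (cot t + 2 * q / (L + 2 * t))).

Lemma sin_phase (k : nat) (t : R) :
  sin (2 * INR k * PI + 2 * t) = 2 * sin t * cos t.
Proof. now rewrite Rplus_comm, sin_period, sin_2a. Qed.

Lemma one_minus_cos_phase (k : nat) (t : R) :
  1 - cos (2 * INR k * PI + 2 * t) = 2 * (sin t * sin t).
Proof. rewrite Rplus_comm, cos_period, cos_2a_sin. ring. Qed.

Lemma trig_eq_phase (c : R) (k : nat) (t : R) :
  0 < t < PI ->
  trig_eq c (2 * INR k * PI + 2 * t)
  = 2 * (sin t * sin t) * (c + bcot (2 * INR k * PI) t).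
Proof.
  intros Ht.
  assert (Hs : 0 < sin t) by (apply sin_gt_0; lra).
  unfold trig_eq, bcot, cot.
  rewrite one_minus_cos_phase, sin_phase. field. lra.
Qed.

(** This polynomial form of the numerator extends continuously to [t = PI],
    where [cot] has a pole; the intermediate value theorem is applied to it. *)
Lemma h2_factor_numerator (xi q L t : R) :
  0 <= L -> 0 < t < PI ->
  2 * q * (L + 2 * t) * (sin t * sin t) - xi * (L + 2 * t)
    - 2 * q * xi * (sin t * cos t)
  = (L + 2 * t) * (sin t * sin t) * h2_factor xi q L t.
Proof.
  intros HL Ht.
  assert (Hs : 0 < sin t) by (apply sin_gt_0; lra).
  pose proof (sin2_cos2 t) as H1. unfold Rsqr in H1.
  replace (xi * (L + 2 * t))
    with (xi * (L + 2 * t) * (sin t * sin t + cos t * cos t))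
    by (rewrite H1; ring).
  unfold h2_factor, cot. field. lra.
Qed.

Lemma h2_num_phase (xi q : R) (k : nat) (t : R) :
  0 < t < PI ->
  h2_num xi q (2 * INR k * PI + 2 * t)
  = (2 * INR k * PI + 2 * t) * (sin t * sin t)
    * h2_factor xi q (2 * INR k * PI) t.
Proof.
  intros Ht.
  assert (HL : 0 <= 2 * INR k * PI).
  { pose proof (pos_INR k). pose proof PI_RGT_0. nra. }
  rewrite <- h2_factor_numerator by assumption.
  unfold h2_num. rewrite one_minus_cos_phase, sin_phase. ring.
Qed.

(** * Zeros of the trigonometric equations *)

Lemma cot_decreasing (s t : R) : 0 < s -> s < t -> t < PI -> cot t < cot s.
Proof.
  intros Hs Hst Ht.
  assert (H1 : 0 < sin s) by (apply sin_gt_0; lra).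
  assert (H2 : 0 < sin t) by (apply sin_gt_0; lra).
  assert (H3 : 0 < sin (t - s)) by (apply sin_gt_0; lra).
  rewrite sin_minus in H3.
  assert (H4 : cot s - cot t
               = (sin t * cos s - cos t * sin s) / (sin s * sin t)).
  { unfold cot. field. lra. }
  assert (0 < (sin t * cos s - cos t * sin s) / (sin s * sin t)).
  { apply Rdiv_lt_0_compat; nra. }
  lra.
Qed.

Lemma cot_PI2 : cot (PI / 2) = 0.
Proof. unfold cot. rewrite cos_PI2. unfold Rdiv. ring. Qed.

Lemma cot_nonneg (t : R) : 0 < t <= PI / 2 -> 0 <= cot t.
Proof.
  intros Ht. rewrite <- cot_PI2.
  destruct (Req_dec t (PI / 2)) as [-> | Hne]; [lra |].
  apply Rlt_le, cot_decreasing; lra.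
Qed.

Lemma cot_neg (t : R) : PI / 2 < t < PI -> cot t < 0.
Proof. intros Ht. rewrite <- cot_PI2. apply cot_decreasing; lra. Qed.

Lemma bcot_nonneg (L t : R) : 0 <= L -> 0 < t <= PI / 2 -> 0 <= bcot L t.
Proof.
  intros HL Ht. pose proof (cot_nonneg t Ht). unfold bcot. nra.
Qed.

Lemma bcot_neg_phase (L t : R) :
  0 <= L -> 0 < t < PI -> bcot L t < 0 -> PI / 2 < t.
Proof.
  intros HL Ht Hneg.
  destruct (Rle_lt_dec t (PI / 2)) as [Hle | Hlt]; [| exact Hlt].
  assert (0 <= bcot L t) by (apply bcot_nonneg; lra). lra.
Qed.

Lemma bcot_decreasing (L s t : R) :
  0 <= L -> PI / 2 < s -> s < t -> t < PI -> bcot L t < bcot L s.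
Proof.
  intros HL Hs Hst Ht.
  pose proof PI_RGT_0.
  assert (cot s < 0) by (apply cot_neg; lra).
  assert (cot t < cot s) by (apply cot_decreasing; lra).
  unfold bcot. nra.
Qed.

(** The level [- c] is negative while [bcot] is nonnegative up to [PI / 2], so
    a crossing can only occur in the second half, where [bcot] decreases. *)
Lemma bcot_crossing (L c s t : R) :
  0 <= L -> 0 < c -> 0 < s < PI -> c + bcot L s = 0 -> 0 < t < PI ->
  (t < s -> 0 < c + bcot L t) /\ (s < t -> c + bcot L t < 0).
Proof.
  intros HL Hc Hs H0 Ht.
  assert (Hs2 : PI / 2 < s) by (apply (bcot_neg_phase L); lra).
  split; intros Hlt.
  - destruct (Rle_lt_dec t (PI / 2)) as [Hle | Hgt].
    + assert (0 <= bcot L t) by (apply bcot_nonneg; lra). lra.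
    + assert (bcot L s < bcot L t) by (apply bcot_decreasing; lra). lra.
  - assert (bcot L t < bcot L s) by (apply bcot_decreasing; lra). lra.
Qed.

Lemma bcot_zero_exists (L c : R) :
  0 <= L -> 0 < c -> exists t, 0 < t < PI /\ c + bcot L t = 0.
Proof.
  intros HL Hc.
  pose proof PI_RGT_0.
  (* Multiplying by [- sin t] removes the pole at [PI]. *)
  destruct (IVT (fun t => - (c * sin t + (L + 2 * t) * cos t)) (PI / 2) PI)
    as [t [Ht H0]].
  - intro t. reg.
  - lra.
  - rewrite sin_PI2, cos_PI2. lra.
  - rewrite sin_PI, cos_PI. lra.
  - assert (t <> PI).
    { intros ->. rewrite sin_PI, cos_PI in H0. lra. }
    exists t. split; [lra |].
    assert (Hs : 0 < sin t) by (apply sin_gt_0; lra).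
    unfold bcot, cot.
    apply (Rmult_eq_reg_l (sin t)); [| lra].
    replace (sin t * (c + (L + 2 * t) * (cos t / sin t)))
      with (c * sin t + (L + 2 * t) * cos t) by (field; lra).
    lra.
Qed.

(** * Sign of the numerator of [h2] *)

Section H2Factor.

Variables xi q L : R.
Hypotheses (Hxi : 0 < xi) (Hq : xi < 2 * q) (HL : 0 <= L).

Lemma h2_factor_increasing (s t : R) :
  0 < s -> s < t -> t <= PI / 2 ->
  h2_factor xi q L s < h2_factor xi q L t.
Proof.
  intros Hs Hst Ht.
  pose proof PI_RGT_0.
  assert (H1 : cot t < cot s) by (apply cot_decreasing; lra).
  assert (H2 : 0 <= cot t) by (apply cot_nonneg; lra).
  assert (H3 : / (L + 2 * t) < / (L + 2 * s))
    by (apply Rinv_lt_contravar; nra).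
  assert (H4 : 0 < / (L + 2 * t)) by (apply Rinv_0_lt_compat; lra).
  unfold h2_factor, Rdiv.
  assert (cot t * (cot t + 2 * q * / (L + 2 * t))
          < cot s * (cot s + 2 * q * / (L + 2 * s))).
  { apply Rmult_le_0_lt_compat; nra. }
  nra.
Qed.

Lemma h2_factor_pos_middle (t : R) :
  0 < t < PI -> - (2 * q) <= bcot L t <= 0 -> 0 < h2_factor xi q L t.
Proof.
  intros Ht Hb. unfold bcot in Hb. unfold h2_factor.
  assert (H1 : cot t <= 0) by nra.
  assert (H2 : 0 <= cot t + 2 * q / (L + 2 * t)).
  { replace (cot t + 2 * q / (L + 2 * t))
      with ((2 * q + (L + 2 * t) * cot t) / (L + 2 * t)) by (field; lra).
    apply Rmult_le_pos; [lra |]. apply Rlt_le, Rinv_0_lt_compat. lra. }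
  assert (cot t * (cot t + 2 * q / (L + 2 * t)) <= 0) by nra.
  nra.
Qed.

Lemma h2_factor_decreasing (s t : R) :
  0 < s < PI -> bcot L s <= - (2 * q) -> s < t -> t < PI ->
  h2_factor xi q L t < h2_factor xi q L s.
Proof.
  intros Hs Hb Hst Ht.
  assert (H1 : cot t < cot s) by (apply cot_decreasing; lra).
  assert (H2 : cot s < 0) by (unfold bcot in Hb; nra).
  assert (H3 : / (L + 2 * t) < / (L + 2 * s))
    by (apply Rinv_lt_contravar; nra).
  assert (H4 : cot s + 2 * q / (L + 2 * s) <= 0).
  { replace (cot s + 2 * q / (L + 2 * s))
      with (- ((- (2 * q) - (L + 2 * s) * cot s) / (L + 2 * s)))
      by (field; lra).
    assert (0 <= (- (2 * q) - (L + 2 * s) * cot s) / (L + 2 * s)).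
    { unfold bcot in Hb. apply Rmult_le_pos; [lra |].
      apply Rlt_le, Rinv_0_lt_compat. lra. }
    lra. }
  unfold h2_factor, Rdiv in *.
  assert ((- cot s) * - (cot s + 2 * q * / (L + 2 * s))
          < (- cot t) * - (cot t + 2 * q * / (L + 2 * t))).
  { apply Rmult_le_0_lt_compat; nra. }
  nra.
Qed.

Let num (t : R) : R :=
  2 * q * (L + 2 * t) * (sin t * sin t) - xi * (L + 2 * t)
    - 2 * q * xi * (sin t * cos t).

Let num_factor (t : R) (Ht : 0 < t < PI) :
  0 < (L + 2 * t) * (sin t * sin t)
  /\ num t = (L + 2 * t) * (sin t * sin t) * h2_factor xi q L t.
Proof.
  split; [| now apply h2_factor_numerator].
  assert (0 < sin t) by (apply sin_gt_0; lra).
  apply Rmult_lt_0_compat; nra.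
Qed.

Let num_continuous : continuity num.
Proof. intro t. unfold num. reg. Qed.

Lemma h2_factor_zero_left :
  exists t, 0 < t < PI / 2 /\ h2_factor xi q L t = 0.
Proof.
  pose proof PI2_1 as HPI.
  (* At [t0 = xi / (2 * q) < 1], the bound [sin t0 < t0] gives
     [2 * q * (sin t0)^2 < xi], so the numerator is negative there. The
     endpoint [t = 0] itself would not do: the numerator vanishes at it when
     [L = 0]. *)
  set (t0 := xi / (2 * q)).
  assert (E0 : 2 * q * t0 = xi) by (unfold t0; field; lra).
  assert (H0 : 0 < t0 < 1) by (split; nra).
  assert (Hs : 0 < sin t0) by (apply sin_gt_0; lra).
  assert (Hs' : sin t0 < t0) by (apply sin_lt_x; lra).
  assert (Hc : 0 < cos t0) by (apply cos_gt_0; lra).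
  assert (Hneg : num t0 < 0).
  { assert (Hss : sin t0 * sin t0 < t0) by nra.
    assert (Hqs : 2 * q * (sin t0 * sin t0) < xi) by nra.
    assert (0 < q * xi) by nra.
    assert (0 < sin t0 * cos t0) by nra.
    unfold num. nra. }
  assert (Hpos : 0 < num (PI / 2)).
  { unfold num. rewrite sin_PI2, cos_PI2. nra. }
  destruct (IVT num t0 (PI / 2) num_continuous) as [t [Ht E]]; try lra.
  assert (t <> PI / 2) by (intros ->; lra).
  exists t. split; [lra |].
  destruct (num_factor t) as [Hp Hf]; [lra |]. nra.
Qed.

Lemma h2_factor_zero_right (s : R) :
  0 < s < PI -> 2 * q + bcot L s = 0 ->
  exists t, s < t < PI /\ h2_factor xi q L t = 0.
Proof.
  intros Hs Es.
  assert (Hpos : 0 < num s).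
  { destruct (num_factor s Hs) as [Hp ->].
    apply Rmult_lt_0_compat; [exact Hp |].
    apply h2_factor_pos_middle; lra. }
  assert (Hneg : num PI < 0).
  { unfold num. rewrite sin_PI, cos_PI. nra. }
  destruct (IVT (- num)%F s PI) as [t [Ht E]];
    try (unfold opp_fct; lra).
  - now apply continuity_opp.
  - unfold opp_fct in E.
    assert (t <> PI) by (intros ->; lra).
    assert (t <> s) by (intros ->; lra).
    exists t. split; [lra |].
    destruct (num_factor t) as [Hp Hf]; [lra |]. nra.
Qed.

(** The two zeros of the factor lie in its monotone outer zones; the middle
    zone, where it is positive without being monotone, joins them. *)
Lemma h2_factor_sign (s : R) :
  0 < s < PI -> 2 * q + bcot L s = 0 ->
  exists u v, 0 < u < PI / 2 /\ s < v < PI /\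
    h2_factor xi q L u = 0 /\ h2_factor xi q L v = 0 /\
    forall t, 0 < t < PI ->
      (t < u \/ v < t -> h2_factor xi q L t < 0) /\
      (u < t < v -> 0 < h2_factor xi q L t).
Proof.
  intros Hs Es.
  assert (Hs2 : PI / 2 < s) by (apply (bcot_neg_phase L); lra).
  destruct h2_factor_zero_left as [u [Hu Eu]].
  destruct (h2_factor_zero_right s Hs Es) as [v [Hv Ev]].
  exists u, v. do 4 (split; [assumption |]).
  intros t Ht. split.
  - intros [Htu | Hvt].
    + rewrite <- Eu. apply h2_factor_increasing; lra.
    + rewrite <- Ev. apply h2_factor_decreasing; try lra.
      assert (bcot L v < bcot L s) by (apply bcot_decreasing; lra). lra.
  - intros Huv.
    destruct (Rle_lt_dec t (PI / 2)) as [Hle | Hgt].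
    + rewrite <- Eu. apply h2_factor_increasing; lra.
    + destruct (Rle_lt_dec t s) as [Hts | Hst].
      * apply h2_factor_pos_middle; [assumption |].
        assert (cot t < 0) by (apply cot_neg; lra).
        split; [| unfold bcot; nra].
        destruct (Req_dec t s) as [-> | Hne]; [lra |].
        assert (bcot L s < bcot L t) by (apply bcot_decreasing; lra). lra.
      * rewrite <- Ev. apply h2_factor_decreasing; try lra.
        assert (bcot L t < bcot L s) by (apply bcot_decreasing; lra). lra.
Qed.

End H2Factor.

(** * Positivity in the original variable *)

Lemma in_interval_phase (k : nat) (b : R) :
  in_interval (S k) b <->
  exists t, 0 < t < PI /\ b = 2 * INR k * PI + 2 * t.
Proof.
  unfold in_interval. rewrite S_INR. split.
  - intros Hb. exists ((b - 2 * INR k * PI) / 2). lra.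
  - intros [t [Ht ->]]. lra.
Qed.

Lemma is_zero_in_trig_eq_phase (k : nat) (c b : R) :
  is_zero_in (S k) (trig_eq c) b <->
  exists t, 0 < t < PI /\ b = 2 * INR k * PI + 2 * t /\
    c + bcot (2 * INR k * PI) t = 0.
Proof.
  unfold is_zero_in. rewrite in_interval_phase. split.
  - intros [[t [Ht ->]] E]. exists t.
    split; [assumption |]. split; [reflexivity |].
    rewrite trig_eq_phase in E by assumption.
    assert (0 < sin t) by (apply sin_gt_0; lra).
    apply Rmult_integral in E. destruct E as [E | E]; [nra | exact E].
  - intros [t [Ht [-> E]]]. split; [now exists t |].
    rewrite trig_eq_phase, E by assumption. ring.
Qed.

Lemma trig_eq_unique_zero (k : nat) (c : R) :
  0 < c -> exists! b, is_zero_in (S k) (trig_eq c) b.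
Proof.
  intros Hc.
  assert (HL : 0 <= 2 * INR k * PI).
  { pose proof (pos_INR k). pose proof PI_RGT_0. nra. }
  destruct (bcot_zero_exists _ c HL Hc) as [s [Hs Es]].
  exists (2 * INR k * PI + 2 * s). split.
  - apply is_zero_in_trig_eq_phase. now exists s.
  - intros b Hb. apply is_zero_in_trig_eq_phase in Hb.
    destruct Hb as [t [Ht [-> Et]]].
    destruct (bcot_crossing _ c s t HL Hc Hs Es Ht).
    destruct (Rtotal_order s t) as [Hlt | [-> | Hlt]]; lra.
Qed.

Lemma Rdiv_pos_iff (x y : R) :
  y <> 0 -> 0 < x / y <-> 0 < x /\ 0 < y \/ x < 0 /\ y < 0.
Proof.
  intros Hy.
  assert (E : x = x / y * y) by (field; assumption).
  split.
  - intros H. destruct (Rdichotomy _ _ Hy); [right | left]; nra.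
  - intros [[Hx Hy'] | [Hx Hy']]; nra.
Qed.

(** The numerator of [delta] and the denominator of [h2] are both positive
    multiples of [trig_eq xi b], so [delta] and [h2] are positive together
    only when [trig_eq (2 * q) b] and the numerator of [h2] both share its
    sign. *)
Lemma delta_h2_positive_signs (xi q b : R) :
  0 < b ->
  delta_h2_positive xi q b <->
  0 < trig_eq xi b /\ 0 < trig_eq (2 * q) b /\ 0 < h2_num xi q b \/
  trig_eq xi b < 0 /\ trig_eq (2 * q) b < 0 /\ h2_num xi q b < 0.
Proof.
  intros Hb.
  assert (Hb2 : 0 < b ^ 2) by now apply pow_lt.
  unfold delta_h2_positive, delta, h2, Rgt.
  replace (delta_num xi b) with (b ^ 2 * trig_eq xi b)
    by (unfold delta_num, trig_eq; ring).
  replace (h2_den xi b) with (b * trig_eq xi b)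
    by (unfold h2_den, trig_eq; ring).
  change (delta_den q b) with (trig_eq (2 * q) b).
  split.
  - intros [H1 [H2 [H3 H4]]].
    apply Rdiv_pos_iff in H3; [| assumption].
    apply Rdiv_pos_iff in H4; [| assumption].
    destruct H3 as [[A B] | [A B]], H4 as [[C D] | [C D]];
      [left | exfalso; nra | exfalso; nra | right];
      repeat split; nra.
  - intros [[A [B C]] | [A [B C]]]; repeat split; try nra.
    + apply Rdiv_pos_iff; [nra | left; split; nra].
    + apply Rdiv_pos_iff; [nra | left; split; nra].
    + apply Rdiv_pos_iff; [nra | right; split; nra].
    + apply Rdiv_pos_iff; [nra | right; split; nra].
Qed.

Theorem theorem3p7 :
  forall (xi q : R) (n : nat),
    0 < xi -> 0 < q -> xi < 2 * q -> (1 <= n)%nat ->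
    (exists! beta_star : R, is_zero_in n (trig_eq xi) beta_star) /\
    (exists! beta_tilde : R, is_zero_in n (trig_eq (2 * q)) beta_tilde) /\
    (forall beta_star beta_tilde : R,
       is_zero_in n (trig_eq xi) beta_star ->
       is_zero_in n (trig_eq (2 * q)) beta_tilde ->
       exists gamma_star gamma_tilde : R,
         2 * (INR n - 1) * PI < gamma_star < beta_star /\
         beta_tilde < gamma_tilde < 2 * INR n * PI /\
         gamma_star <> gamma_tilde /\
         (forall b : R,
            is_h2_zero xi q n b <-> b = gamma_star \/ b = gamma_tilde) /\
         (forall b : R, in_interval n b ->
            (delta_h2_positive xi q b <->
             gamma_star < b < beta_star \/
             gamma_tilde < b < 2 * INR n * PI))).
Proof.
  intros xi q [| k] Hxi Hq Hxq Hn; [inversion Hn |].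
  split; [now apply trig_eq_unique_zero |].
  split; [apply trig_eq_unique_zero; lra |].
  intros bs bt Hbs Hbt.
  apply is_zero_in_trig_eq_phase in Hbs, Hbt.
  destruct Hbs as [s [Hs [-> Es]]], Hbt as [r [Hr [-> Er]]].
  pose proof PI_RGT_0 as HPI.
  pose proof (in_interval_phase k) as Hphase.
  pose proof (fun c t => trig_eq_phase c k t) as Htrig.
  pose proof (fun t => h2_num_phase xi q k t) as Hnum.
  rewrite S_INR.
  assert (HL : 0 <= 2 * INR k * PI) by (pose proof (pos_INR k); nra).
  replace (2 * (INR k + 1 - 1) * PI) with (2 * INR k * PI) by ring.
  replace (2 * (INR k + 1) * PI) with (2 * INR k * PI + 2 * PI) by ring.
  set (L := 2 * INR k * PI) in *.
  assert (Hs2 : PI / 2 < s) by (apply (bcot_neg_phase L); lra).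
  assert (Hsr : s < r).
  { destruct (bcot_crossing L (2 * q) r s) as [_ H]; try lra.
    destruct (Rtotal_order s r) as [Hlt | [-> | Hlt]]; lra. }
  destruct (h2_factor_sign xi q L Hxi Hxq HL r Hr Er)
    as [u [v [Hu [Hv [Eu [Ev Hsign]]]]]].
  (* Each of the three expressions has the sign of its last factor. *)
  assert (Hw : forall t, 0 < t < PI ->
            0 < sin t * sin t /\ 0 < (L + 2 * t) * (sin t * sin t)).
  { intros t Ht. assert (0 < sin t) by (apply sin_gt_0; lra).
    assert (0 < sin t * sin t) by nra. split; nra. }
  exists (L + 2 * u), (L + 2 * v).
  do 3 (split; [lra |]). split.
  - intros b. unfold is_h2_zero. rewrite Hphase.
    assert (Hden : forall c, h2_den xi c = c * trig_eq xi c)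
      by (intro c; unfold h2_den, trig_eq; ring).
    unfold h2. rewrite Hden.
    split.
    + intros [[t [Ht ->]] [H1 H2]].
      assert (H0 : h2_num xi q (L + 2 * t) = 0).
      { apply (Rmult_eq_reg_r (/ ((L + 2 * t) * trig_eq xi (L + 2 * t)))).
        - rewrite Rmult_0_l. exact H2.
        - now apply Rinv_neq_0_compat. }
      rewrite Hnum in H0 by assumption.
      destruct (Hw t Ht), (Hsign t Ht) as [Hout Hin].
      destruct (Rtotal_order t u) as [A | [-> | A]];
        [| now left |]; [nra |].
      destruct (Rtotal_order t v) as [B | [-> | B]];
        [| now right |]; nra.
    + assert (Hz : forall t, 0 < t < PI -> t <> s ->
                h2_factor xi q L t = 0 ->
                (exists t', 0 < t' < PI /\ L + 2 * t = L + 2 * t') /\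
                (L + 2 * t) * trig_eq xi (L + 2 * t) <> 0 /\
                h2_num xi q (L + 2 * t)
                  / ((L + 2 * t) * trig_eq xi (L + 2 * t)) = 0).
      { intros t Ht Hts E. split; [now exists t |].
        destruct (Hw t Ht).
        destruct (bcot_crossing L xi s t HL Hxi Hs Es Ht).
        rewrite Hnum, Htrig, E by assumption.
        split; [| unfold Rdiv; ring].
        apply Rmult_integral_contrapositive_currified; [lra |].
        destruct (Rdichotomy _ _ Hts); nra. }
      intros [-> | ->]; apply Hz; lra.
  - intros b Hb. apply Hphase in Hb. destruct Hb as [t [Ht ->]].
    rewrite delta_h2_positive_signs by lra.
    rewrite !Htrig, Hnum by assumption.
    destruct (Hw t Ht) as [W1 W2], (Hsign t Ht) as [Hout Hin].
    destruct (bcot_crossing L xi s t HL Hxi Hs Es Ht) as [A1 A2].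
    assert (Hc : 0 < 2 * q) by lra.
    destruct (bcot_crossing L (2 * q) r t HL Hc Hr Er Ht) as [B1 B2].
    split.
    + intros [[P1 [P2 P3]] | [P1 [P2 P3]]]; [left | right].
      * assert (Hts : t < s).
        { destruct (Rtotal_order t s) as [H | [E | H]]; [easy | |];
            [subst t; rewrite Es in P1 | specialize (A2 H)]; nra. }
        assert (Hut : u < t).
        { destruct (Rtotal_order u t) as [H | [E | H]]; [easy | |];
            [subst t; rewrite Eu in P3 | specialize (Hout (or_introl H))]; nra. }
        lra.
      * assert (Hrt : r < t).
        { destruct (Rtotal_order r t) as [H | [E | H]]; [easy | |];
            [subst t; rewrite Er in P2 | specialize (B1 H)]; nra. }
        assert (Hvt : v < t).
        { destruct (Rtotal_order v t) as [H | [E | H]]; [easy | |];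
            [subst t; rewrite Ev in P3; nra |].
          assert (0 < h2_factor xi q L t) by (apply Hin; lra). nra. }
        lra.
    + intros [H | H]; [left | right].
      * assert (0 < xi + bcot L t) by (apply A1; lra).
        assert (0 < h2_factor xi q L t) by (apply Hin; lra).
        repeat split; nra.
      * assert (xi + bcot L t < 0) by (apply A2; lra).
        assert (2 * q + bcot L t < 0) by (apply B2; lra).
        assert (h2_factor xi q L t < 0) by (apply Hout; right; lra).
        repeat split; nra.
Qed.
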